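(* Let $f$ be a convex function on $(0,\infty)$ with $f(1)=f'(1)=0$ and $f''(1)=1$, and set $f(0)=\lim_{u\downarrow 0} f(u)$. Let $g_1,g_2$ be two probability density functions on $\mathcal{X}$ with respect to a common measure $\mu$. Let $\delta>0$, and let $\Delta_*(\delta)$ be the solution of the following equation in $\Delta\ge 1$: $$\Bigl(\frac{1}{\Delta}\Bigr)f(\Delta)+\Bigl(1-\frac{1}{\Delta}\Bigr)f(0)=\delta$$ ($\delta$ is assumed to be such that a solution exists). Define $$A(\delta)=\Bigl\{(x,t)\ \Big|\ x f\Bigl(\frac{1-2t}{x}+1\Bigr)+(1-x)f\Bigl(\frac{2t-1}{1-x}+1\Bigr)=\delta,\quad 0<x<2t<1\Bigr\}$$ and $$\alpha(\delta)=\min\Bigl(\frac{1}{2\Delta_*(\delta)},\ \inf\{t \mid (x,t)\in A(\delta)\}\Bigr).$$ If $D_f[g_1(x)\,|\,g_2(x)]<\delta$, then $$Er[g_1(x)\,|\,g_2(x)]\ \ge\ \alpha(\delta).$$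
   Context: The $f$-divergence between two densities $g_1,g_2$ with respect to $\mu$ on $\mathcal{X}$ is $$D_f[g_1(x)\,|\,g_2(x)]=\int_{\mathcal{X}} g_1(x)\, f\Bigl(\frac{g_2(x)}{g_1(x)}\Bigr)d\mu(x),$$ with the usual conventions for $f$-divergences where a density vanishes ($0\,f(0/0)=0$ and $0\,f(b/0)=b\lim_{u\to\infty}f(u)/u$ for $b>0$). The Bayes error rate (the minimal error probability of discriminating between the two distributions with equal prior weights) is $$Er[g_1(x)\,|\,g_2(x)]=\frac12\int_{\mathcal{X}}\min(g_1(x),g_2(x))\,d\mu.$$ The infimum of the empty set is $+\infty$. *)

(* Defs.v *)
(* MathComp / MathComp-Analysis *)
From mathcomp Require Export all_boot all_order all_algebra.
From mathcomp Require Export all_classical all_reals all_analysis.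
Export Order.TTheory GRing.Theory Num.Theory numFieldNormedType.Exports.

Set Implicit Arguments.
Unset Strict Implicit.
Unset Printing Implicit Defensive.

Local Open Scope classical_set_scope.
Local Open Scope ring_scope.

(* Only the restriction of f to ]0, +oo[ is meaningful; its value at 0 is the
   right limit, which may be +oo.  Differentiability near 1 is spelled out
   because f^`() is a total function. *)
Definition divergence_generator (R : realType) (f : R -> R) : Prop :=
  [/\ @convex_function R R^o `]0, +oo[%classic f,
      f 1 = 0,
      (\forall u \near (1 : R), derivable f u 1) /\ (f^`())%classic 1 = 0 &
      derivable (f^`())%classic 1 1 /\ (f^`(2))%classic 1 = 1].

Definition f_at0 (R : realType) (f : R -> R) : \bar R :=
  lim ((f u)%:E @[u --> (0 : R)^'+]).

Definition f_slope_oo (R : realType) (f : R -> R) : \bar R :=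
  lim ((f u / u)%:E @[u --> +oo%R]).

Definition f_ext (R : realType) (f : R -> R) (u : R) : \bar R :=
  if u == 0 then f_at0 f else (f u)%:E.

(* The integrand a * f (b / a), for a, b >= 0. *)
Definition fdiv_integrand (R : realType) (f : R -> R) (a b : R) : \bar R :=
  if a == 0 then (if b == 0 then 0%E else (b%:E * f_slope_oo f)%E)
  else (a%:E * f_ext f (b / a))%E.

Definition is_density d (T : measurableType d) (R : realType)
    (mu : {measure set T -> \bar R}) (g : T -> R) : Prop :=
  [/\ measurable_fun [set: T] g,
      (forall x, 0 <= g x) &
      (\int[mu]_x (g x)%:E = 1)%E].

Definition f_divergence d (T : measurableType d) (R : realType)
    (mu : {measure set T -> \bar R}) (f : R -> R) (g1 g2 : T -> R) : \bar R :=
  (\int[mu]_x fdiv_integrand f (g1 x) (g2 x))%E.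

Definition bayes_error d (T : measurableType d) (R : realType)
    (mu : {measure set T -> \bar R}) (g1 g2 : T -> R) : \bar R :=
  ((2^-1)%:E * \int[mu]_x (Num.min (g1 x) (g2 x))%:E)%E.

(* When f(0) = +oo, the product with 1 - 1/Delta follows 0 * +oo = 0, so that
   the equation has no solution for 0 < delta. *)
Definition Delta_star_solution (R : realType) (f : R -> R) (delta Delta : R) :
    Prop :=
  1 <= Delta /\
  ((Delta^-1 * f Delta)%:E + (1 - Delta^-1)%:E * f_at0 f = delta%:E)%E.

Definition A_set (R : realType) (f : R -> R) (delta : R) : set (R * R) :=
  [set p | let: (x, t) := p in
     [/\ x * f ((1 - 2 * t) / x + 1)
           + (1 - x) * f ((2 * t - 1) / (1 - x) + 1) = delta,
         0 < x, x < 2 * t & 2 * t < 1]].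

(* Extended-real infimum, so that the infimum of the empty set is +oo. *)
Definition alpha (R : realType) (f : R -> R) (delta Delta : R) : \bar R :=
  Order.min ((2 * Delta)^-1)%:E (ereal_inf [set p.2%:E | p in A_set f delta]).

(* Main.v *)
(* Put x = int_{g1 <= g2} g1, y = int_{g1 <= g2} g2 and s = 2 Er = x + 1 - y.
   The perspective a f(b/a) is bounded below by p a + q b for every affine
   minorant p + q u of f.  Integrating one minorant over {g1 <= g2} and another
   over its complement gives, with Phi the left-hand side of the equation of
   A(delta) at t = s/2, Phi(x) <= D_f, with limiting versions at x = 0, x = s.
   If Er < alpha(delta), then s Delta_* < 1, and monotonicity of the slopes
   f(u)/(u-1) gives Phi > delta near s, while Phi < delta at x or near 0.  The
   intermediate value theorem then gives a point of A(delta) with t = Er,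
   contradicting Er < inf {t}. *)
Require Import Defs.
From mathcomp Require Import measurable_realfun ring lra.

Set Implicit Arguments.
Unset Strict Implicit.
Unset Printing Implicit Defensive.

Local Open Scope classical_set_scope.
Local Open Scope ring_scope.

Definition minorant (R : realType) (f : R -> R) (p q : R) : Prop :=
  forall v, 0 < v -> p + q * v <= f v.

(** * Convex functions on the positive half-line: chords, support lines, continuity *)

Section ConvexOnPositiveReals.
Variables (R : realType) (f : R -> R).
Hypothesis convex_f : @convex_function R R^o `]0, +oo[%classic f.

Lemma convex_three_points (u v w : R) : 0 < u -> u < v -> v < w ->
  (w - u) * f v <= (w - v) * f u + (v - u) * f w.
Proof.
move=> u0 uv vw; have uw : 0 < w - u by lra.
have t01 : 0 <= (w - v) / (w - u) <= 1.
  by rewrite divr_ge0 ?ler_pdivrMr /=; lra.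
have pos z : 0 < z -> (z : convex_lmodType R^o) \in `]0, +oo[%classic.
  by move=> z0; rewrite inE /= in_itv /= z0.
have := @convex_f (Itv01 (andP t01).1 (andP t01).2) u w (pos u u0)
  (pos w (lt_trans u0 (lt_trans uv vw))).
rewrite convRE /=; set c := conv _ _ _.
have -> : c = v.
  rewrite {}/c [LHS](_ : _ = (w - v) / (w - u) * u
    + (1 - (w - v) / (w - u)) * w) //.
  by field; rewrite gt_eqF.
rewrite -(ler_pM2l uw); move/le_trans; apply.
rewrite le_eqVlt; apply/orP; left; apply/eqP; rewrite /unstable.onem.
by field; rewrite gt_eqF.
Qed.

(** The slope is the supremum of the left chord slopes at [u]. By the three-point inequality every
    right chord slope bounds them from above, so the line of this slope stays below [f] on both
    sides. *)
Lemma convex_support (u : R) : 0 < u ->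
  exists q, minorant f (f u - q * u) q.
Proof.
move=> u0; pose S := [set (f u - f v) / (u - v) | v in `]0, u[].
have ub w : u < w -> ubound S ((f w - f u) / (w - u)).
  move=> uw _ [v /= /[!in_itv] /= /andP[v0 vu] <-].
  have := convex_three_points v0 vu uw.
  rewrite ler_pdivrMr ?subr_gt0// mulrAC.
  rewrite ler_pdivlMr ?subr_gt0//.
  lra.
have S0 : S !=set0.
  exists ((f u - f (u / 2)) / (u - u / 2)), (u / 2) => //=.
  by rewrite in_itv /=; lra.
have hS : has_sup S.
  by split=> //; eexists; apply: (ub (u + 1)); lra.
exists (sup S) => v v0; have [vu|uv|->] := ltgtP v u; last lra.
  have : (f u - f v) / (u - v) <= sup S.
    by apply: sup_upper_bound => //; exists v => //=; rewrite in_itv /= v0.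
  by rewrite ler_pdivrMr; lra.
have : sup S <= (f v - f u) / (v - u) by apply: ge_sup => //; exact: ub.
by rewrite ler_pdivlMr; lra.
Qed.

(** [f] is Lipschitz at [u]: a support line bounds it from below, the chords from [u] to [u - r] and
    [u + r] from above. The choice [r = u / 2] keeps these points positive. *)
Lemma convex_continuous (u : R) : 0 < u -> {for u, continuous f}.
Proof.
move=> u0; have [q minq] := convex_support u0.
pose r := u / 2; have r0 : 0 < r by rewrite /r; lra.
pose C : R := `|q| + `|(f (u + r) - f u) / r| + `|(f (u - r) - f u) / r|.
have lip v : `|v - u| < r -> `|f u - f v| <= C * `|u - v|.
  rewrite ltr_distl => /andP[v1 v2].
  have v0 : 0 < v by rewrite /r in v1; lra.
  have lo := minq v v0.
  have b1 : f (u + r) - f u = (f (u + r) - f u) / r * r.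
    by rewrite divfK ?gt_eqF.
  have b2 : f (u - r) - f u = (f (u - r) - f u) / r * r.
    by rewrite divfK ?gt_eqF.
  move: b1 b2; rewrite /C.
  set s := _ / r; set t := _ / r => b1 b2.
  have [Q1 Q2] : - `|q| <= q /\ q <= `|q|.
    by apply/andP; rewrite -ler_norml.
  have [S1 S2] : - `|s| <= s /\ s <= `|s| by apply/andP; rewrite -ler_norml.
  have [T1 T2] : - `|t| <= t /\ t <= `|t| by apply/andP; rewrite -ler_norml.
  have [s0 t0] : 0 <= `|s| /\ 0 <= `|t| by [].
  rewrite ler_norml.
  have [vu|uv|->] := ltgtP v u; last by rewrite !subrr normr0 mulr0 oppr0 lexx.
    have := @convex_three_points (u - r) v u ltac:(rewrite /r; lra) v1 vu.
    rewrite [`|u - v|]gtr0_norm ?subr_gt0//= => three.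
    have hi : f v - f u <= t * (u - v).
      by rewrite -(ler_pM2r r0) mulrAC -b2; lra.
    by apply/andP; split; nra.
  have := @convex_three_points u v (u + r) u0 uv v2.
  rewrite [`|u - v|]ltr0_norm ?subr_lt0//= => three.
  have hi : f v - f u <= s * (v - u).
    by rewrite -(ler_pM2r r0) mulrAC -b1; lra.
  by apply/andP; split; nra.
apply/cvgrPdist_lt => e e0.
have C1 : 0 < C + 1 by rewrite ltr_wpDl// /C !addr_ge0.
have : 0 < Num.min r (e / (C + 1)) by rewrite lt_min r0 divr_gt0.
move=> d0; near=> v.
have : `|u - v| < Num.min r (e / (C + 1)).
  by near: v; apply: (@cvgr_dist_lt _ _ _ _ _ id u); [exact: cvg_id|].
rewrite lt_min (ltr_pdivlMr _ _ C1).
move=> /andP[vr ve].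
rewrite (le_lt_trans (lip v _)) ?[`|v - u|]distrC// (le_lt_trans _ ve)//.
by rewrite mulrC ler_wpM2l// lerDl.
Unshelve. all: by end_near. Qed.

End ConvexOnPositiveReals.

(** * Sign, monotonicity and limits of a divergence generator *)

Section Generator.
Variables (R : realType) (f : R -> R).
Hypothesis gen_f : divergence_generator f.

Let convex_f : @convex_function R R^o `]0, +oo[%classic f.
Proof. by case: gen_f. Qed.

Let f1 : f 1 = 0.
Proof. by case: gen_f. Qed.

(** If [q] is the slope of a support line at 1, then [f v - q * v] is minimal at 1, so its
    derivative [f'(1) - q] vanishes there and [q = 0]. *)
Lemma generator_ge0 (u : R) : 0 < u -> 0 <= f u.
Proof.
have [_ _ [df f'1] _] := gen_f.
have [q minq] := convex_support convex_f ltr01.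
suff q0 : q = 0 by move=> u0; have := minq u u0; rewrite q0 f1; lra.
have [e /= e0 ball_e] : \forall u \near (1 : R), derivable f u 1 /\ 0 < u.
  by near=> z; split; near: z => //; exact: lt_nbhsr.
pose g (v : R) : R := f v + (- q *: (@id R)) v.
have gE v : g v = f v - q * v.
  by rewrite /g; congr (_ + _); exact: mulNr.
have dg t : t \in `](1 - e), (1 + e)[%R -> derivable g t 1.
  rewrite in_itv /= => t1; apply: derivableD.
    by apply: (ball_e t _).1; rewrite /= ltr_distlC.
  exact: derivableZ.
have gmin t : t \in `](1 - e), (1 + e)[%R -> g 1 <= g t.
  rewrite in_itv /= => t1.
  have t0 : 0 < t by apply: (ball_e t _).2; rewrite /= ltr_distlC.
  by have := minq t t0; rewrite !gE f1; lra.
have e1 : 1 \in `](1 - e), (1 + e)[%R by rewrite in_itv /=; lra.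
have e2 : 1 - e <= 1 + e by lra.
have d1 : derivable f 1 1.
  by apply: (ball_e 1 _).1; rewrite /= subrr normr0.
have := @derive_val _ _ _ _ _ _ _ (derive1_at_min e2 dg e1 gmin).
have d2 : derivable (- q *: @id R) 1 1 by exact: derivableZ.
rewrite (deriveD d1 d2) deriveZ; last exact: derivable_id.
rewrite derive_id -derive1E f'1.
by rewrite [_ *: _]mulr1; lra.
Unshelve. all: by end_near. Qed.

(** A support line at [v] has value at most [f 1 = 0] at 1 and value [f v >= 0] at [v < 1], so its
    slope is nonpositive. *)
Lemma generator_nonincreasing (u v : R) : 0 < u -> u <= v -> v < 1 ->
  f v <= f u.
Proof.
move=> u0 uv v1; have [q minq] := convex_support convex_f (lt_le_trans u0 uv).
have v0 : 0 < v by lra.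
have := minq 1 ltr01; have := minq u u0; have := generator_ge0 v0.
by rewrite f1; nra.
Qed.

Lemma generator_slope_nondecreasing (u v : R) : 1 < u -> u <= v ->
  f u * (v - 1) <= f v * (u - 1).
Proof.
rewrite le_eqVlt => u1 /predU1P[->//|uv].
have := convex_three_points convex_f ltr01 u1 uv.
by rewrite f1; lra.
Qed.

(** For [u > 1], [f u / u] is the product of [f u / (u - 1)] and [1 - 1 / u], both nonnegative and
    nondecreasing. *)
Lemma generator_ratio_nondecreasing (u v : R) : 1 <= u -> u <= v ->
  f u / u <= f v / v.
Proof.
move=> u1 uv; have [u0 v0] : 0 < u /\ 0 < v by lra.
rewrite ler_pdivrMr// mulrAC ler_pdivlMr//.
move: u1; rewrite le_eqVlt => /predU1P[<-|u1].
  by rewrite f1; have := @generator_ge0 v ltac:(lra); lra.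
have := generator_slope_nondecreasing u1 uv.
have := @generator_ge0 u ltac:(lra).
have := @generator_ge0 v ltac:(lra).
nra.
Qed.

(** Monotonicity on []0, 1[] makes the [lim] in [f_at0] a genuine limit, possibly [+oo], and
    identifies it as a supremum. *)
Lemma f_at0_cvg :
  (f u)%:E @[u --> 0^'+] --> ereal_sup [set (f u)%:E | u in `]0, 1[].
Proof.
apply: (@nonincreasing_at_right_cvge _ _ _ (BLeft 1)).
  by rewrite bnd_simp.
move=> u v; rewrite !in_itv /= => /andP[u0 u1] /andP[v0 v1] uv.
by rewrite lee_fin generator_nonincreasing.
Qed.

Lemma f_at0E : f_at0 f = ereal_sup [set (f u)%:E | u in `]0, 1[].
Proof. exact/cvg_lim/f_at0_cvg. Qed.

Lemma f_at0_ge (u : R) : 0 < u -> u < 1 -> ((f u)%:E <= f_at0 f)%E.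
Proof.
move=> u0 u1; rewrite f_at0E; apply: ereal_sup_ubound.
by exists u => //=; rewrite in_itv /= u0.
Qed.

Lemma f_slope_oo_is_cvg : cvg ((f u / u)%:E @[u --> +oo%R]).
Proof.
(* Truncation at 1 gives a function monotone on the whole line that agrees with [f u / u] for large
   [u]. *)
pose g u := (f (Num.max 1 u) / Num.max 1 u)%:E.
apply/cvg_ex; exists (ereal_sup (range g)).
apply: cvg_trans (_ : g u @[u --> +oo] --> _); last first.
  apply: nondecreasing_cvge => u v uv; rewrite lee_fin.
  by apply: generator_ratio_nondecreasing; [rewrite le_max lexx|exact: le_max2].
apply: near_eq_cvg; near=> u; rewrite /g max_r//.
Unshelve. all: by end_near. Qed.

End Generator.

(** * Affine lower bounds for the integrand, boundary conventions included *)

Section Perspective.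
Variables (R : realType) (f : R -> R).
Hypothesis gen_f : divergence_generator f.

Lemma minorant_le_f_at0 (p q : R) : minorant f p q -> (p%:E <= f_at0 f)%E.
Proof.
move=> minpq; apply/lee_subgt0Pr => e e0.
(* This [v] satisfies [v < 1] and [|q| * v <= e], whence [p - e <= p + q * v <= f v]. *)
pose v := Num.min (2^-1) (e / (`|q| + 1)).
have q1 : 0 < `|q| + 1 by rewrite ltr_wpDl.
have v0 : 0 < v by rewrite lt_min invr_gt0 ltr0n divr_gt0.
have v1 : v < 1 by rewrite gt_min; apply/orP; left; lra.
have ve : v * (`|q| + 1) <= e by rewrite -ler_pdivlMr// ge_min lexx orbT.
apply: le_trans (f_at0_ge gen_f v0 v1); rewrite -EFinB lee_fin.
have := minpq v v0; have : - `|q| <= q by rewrite lerNl ler_normr lexx orbT.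
nra.
Qed.

Lemma minorant_le_f_slope_oo (p q : R) :
  minorant f p q -> (q%:E <= f_slope_oo f)%E.
Proof.
move=> minpq; apply/lee_subgt0Pr => e e0.
apply: lime_ge; first exact: f_slope_oo_is_cvg.
near=> u; have u0 : 0 < u by near: u; apply: nbhs_pinfty_gt; rewrite num_real.
rewrite -EFinB lee_fin ler_pdivlMr//.
have : - p / e <= u by near: u; apply: nbhs_pinfty_ge; rewrite num_real.
rewrite ler_pdivrMr//; have := minpq u u0; lra.
Unshelve. all: by end_near. Qed.

(** For positive [a] and [b], evaluate the minorant at [b / a] and multiply by [a]. When [b = 0]
    only the intercept matters, when [a = 0] only the slope; the limits of [f] at 0 and of [f u / u]
    at infinity dominate them. *)
Lemma minorant_le_fdiv_integrand (p q a b : R) : minorant f p q ->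
  0 <= a -> 0 <= b -> ((p * a + q * b)%:E <= fdiv_integrand f a b)%E.
Proof.
move=> minpq; rewrite /fdiv_integrand /f_ext [0 <= a]le_eqVlt.
move=> /predU1P[<-|a0] b0.
  rewrite eqxx mulr0 add0r; case: eqVneq => [->|_]; first by rewrite mulr0.
  rewrite mulrC EFinM lee_wpmul2l ?lee_fin//.
  exact: minorant_le_f_slope_oo minpq.
rewrite gt_eqF// mulf_eq0 invr_eq0 (gt_eqF a0) orbF.
move: b0; rewrite [0 <= b]le_eqVlt => /predU1P[<-|b0].
  rewrite eqxx mulr0 addr0 mulrC EFinM lee_wpmul2l ?lee_fin ?(ltW a0)//.
    exact: minorant_le_f_at0 minpq.
rewrite gt_eqF// -EFinM lee_fin.
rewrite [leLHS](_ : _ = a * (p + q * (b / a))).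
  by rewrite ler_pM2l// minpq// divr_gt0.
by field; rewrite gt_eqF.
Qed.

Lemma fdiv_integrand_ge0 (a b : R) : 0 <= a -> 0 <= b ->
  (0 <= fdiv_integrand f a b)%E.
Proof.
move=> a0 b0; have min0 : minorant f 0 0.
  by move=> v v0; rewrite mul0r addr0 generator_ge0.
by have := minorant_le_fdiv_integrand min0 a0 b0; rewrite !mul0r addr0.
Qed.
End Perspective.

(* Unlike ge0_le_integral, this does not require F to be measurable. *)
Lemma ge0_le_integralT d (T : measurableType d) (R : realType)
    (mu : {measure set T -> \bar R}) (h F : T -> \bar R) :
  mu.-integrable setT h -> (forall x, 0 <= F x)%E ->
  (forall x, h x <= F x)%E -> (\int[mu]_x h x <= \int[mu]_x F x)%E.
Proof.
move=> inth F0 hF; rewrite integralE.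
apply: (@le_trans _ _ (\int[mu]_x h^\+ x)%E).
  by rewrite leeBlDl ?integrable_neg_fin_num// leeDr// integral_ge0.
(* Both integrals are suprema over simple functions, and one lying below the positive part of [h]
   also lies below [F]. *)
rewrite !ge0_integralTE//; apply: ereal_sup_le => _ [s hs <-].
by exists s => // x; apply: le_trans (hs x) _; rewrite funeposE ge_max hF F0.
Qed.

(** * Integrals of the densities over the set where [g1 <= g2] and its complement *)

Section Measure.
Context d (T : measurableType d) (R : realType).
Variable mu : {measure set T -> \bar R}.

Lemma density_integrable (g : T -> R) :
  is_density mu g -> mu.-integrable setT (EFin \o g).
Proof.
move=> [mg g0 int_g]; apply/integrableP; split; first exact/measurable_EFinP.
under eq_integral => x _ do rewrite /= ger0_norm//.
by rewrite int_g ltry.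
Qed.

Lemma density_Rintegral (g : T -> R) :
  is_density mu g -> \int[mu]_x g x = 1.
Proof. by move=> [_ _ int_g]; rewrite /Rintegral int_g. Qed.

Lemma Rintegral_setC (A : set T) (g : T -> R) : measurable A ->
  is_density mu g -> \int[mu]_(x in ~` A) g x = 1 - \int[mu]_(x in A) g x.
Proof.
move=> mA dg; rewrite -(density_Rintegral dg) -(setUv A) Rintegral_setU//.
- by rewrite addrC addKr.
- exact: measurableC.
- by rewrite setUv; exact: density_integrable.
- by apply/disj_setPCl.
Qed.

Section TwoDensities.
Variables g1 g2 : T -> R.
Hypotheses (dg1 : is_density mu g1) (dg2 : is_density mu g2).

Let A := [set t | g1 t <= g2 t].

Lemma measurable_density_le : measurable A.
Proof.
have [mg1 _ _] := dg1; have [mg2 _ _] := dg2.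
by have := measurable_fun_le measurableT mg1 mg2; rewrite setTI.
Qed.

Let mA := measurable_density_le.

Let mCA : measurable (~` A).
Proof. exact: measurableC. Qed.

Let intg (B : set T) g : measurable B -> is_density mu g ->
  mu.-integrable B (EFin \o g).
Proof. by move=> mB /density_integrable; apply: integrableS. Qed.

Lemma bayes_errorE : bayes_error mu g1 g2 =
  (2^-1 * (\int[mu]_(t in A) g1 t + (1 - \int[mu]_(t in A) g2 t)))%:E.
Proof.
rewrite -Rintegral_setC// EFinM; congr (_ * _)%E.
rewrite -(setUv A) ge0_integral_setU//; first 1 last.
- rewrite setUv; apply/measurable_EFinP.
  by have [mg1 _ _] := dg1; have [mg2 _ _] := dg2; exact: measurable_minr.
- move=> x _; have [_ + _] := dg1; have [_ + _] := dg2.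
  by move=> /(_ x) ? /(_ x) ?; rewrite lee_fin le_min; apply/andP.
- by apply/disj_setPCl.
rewrite EFinD /Rintegral !fineK; [|exact: integrable_fin_num (intg _ _)..].
congr (_ + _)%E; apply: eq_integral => t.
  by rewrite inE => /= ?; rewrite min_l.
by rewrite inE => /= /negP; rewrite -ltNge => /ltW ?; rewrite min_r.
Qed.

Lemma Rintegral_combination (B : set T) (p q : R) : measurable B ->
  mu.-integrable B (fun t => (p * g1 t + q * g2 t)%:E) /\
  (\int[mu]_(t in B) (p * g1 t + q * g2 t)%:E)%E =
    (p * \int[mu]_(t in B) g1 t + q * \int[mu]_(t in B) g2 t)%:E.
Proof.
move=> mB; have [i1 i2] := (intg mB dg1, intg mB dg2).
have j1 := integrableZl mB p i1; have j2 := integrableZl mB q i2.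
split; first exact: integrableD j1 j2.
under eq_integral do rewrite EFinD !EFinM.
rewrite (integralD mB j1 j2) !integralZl// EFinD !EFinM /Rintegral !fineK//.
all: exact: integrable_fin_num.
Qed.

(** This is Jensen's inequality on each of the two pieces, kept in terms of minorants so that it
    also serves when a piece has zero mass under one density. *)
Lemma f_divergence_ge (f : R -> R) (p q p' q' : R) :
  divergence_generator f -> minorant f p q -> minorant f p' q' ->
  ((p * \int[mu]_(t in A) g1 t + q * \int[mu]_(t in A) g2 t +
    (p' * (1 - \int[mu]_(t in A) g1 t) + q' * (1 - \int[mu]_(t in A) g2 t)))%:E
    <= f_divergence mu f g1 g2)%E.
Proof.
move=> gen_f minpq minpq'.
have [[_ g1_ge0 _] [_ g2_ge0 _]] := (dg1, dg2).
have [iA eA] := Rintegral_combination p q mA.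
have [iC eC] := Rintegral_combination p' q' mCA.
have jA := (integrable_mkcond _ mA).1 iA.
have jC := (integrable_mkcond _ mCA).1 iC.
rewrite -!Rintegral_setC// EFinD -eA -eC integral_mkcond.
(* Extended by zero, the two affine bounds add up to one integrable function on [T], compared
   pointwise with the integrand. *)
rewrite [X in (_ + X)%E]integral_mkcond -integralD//.
apply: ge0_le_integralT; first exact: integrableD.
  by move=> t; exact: fdiv_integrand_ge0.
move=> t; rewrite /patch in_setC; case: ifPn => _ /=.
  by rewrite adde0 minorant_le_fdiv_integrand.
by rewrite add0e minorant_le_fdiv_integrand.
Qed.

End TwoDensities.
End Measure.

(** With [k = f Delta / (Delta - 1)] the equation reads [delta = (1 - 1 / Delta) * (k + f(0))], and
    [s * Delta < 1] gives [1 - 1 / Delta < 1 - s]. The strict gap leaves room to replace [f(0)] by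
    some [f v]. *)
Lemma Delta_star_gap (R : realType) (f : R -> R) (delta Delta s : R) :
  divergence_generator f -> 0 < delta -> Delta_star_solution f delta Delta ->
  s * Delta < 1 ->
  1 < Delta /\ exists v, [/\ 0 < v, v < 1 &
    delta < (1 - s) * (f Delta / (Delta - 1) + f v)].
Proof.
move=> gen_f delta0 [D1 eqD] sD.
have [_ f1 _ _] := gen_f.
have D_gt1 : 1 < Delta.
  rewrite lt_neqAle D1 andbT; apply/eqP => D_eq1; move: eqD.
  rewrite -D_eq1 f1 invr1 mulr0 subrr mul0e adde0 => -[delta_eq0].
  by rewrite -delta_eq0 ltxx in delta0.
split=> //.
have D0 : 0 < Delta by lra.
have iD : 0 < 1 - Delta^-1 by rewrite subr_gt0 invf_lt1.
have f0_lb : (0%:E <= f_at0 f)%E.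
  have h : (2^-1 : R) < 1 by lra.
  have h0 : 0 < (2^-1 : R) by lra.
  by apply: le_trans (f_at0_ge gen_f h0 h); rewrite lee_fin generator_ge0.
(* An infinite [f(0)] has the positive coefficient [1 - 1 / Delta], so the left side would be
   [+oo]. *)
case E0 : (f_at0 f) eqD f0_lb => [f0| |//]; last by rewrite gt0_muley ?lte_fin.
move=> [eqD] _.
set k := f Delta / (Delta - 1).
have kE : f Delta = k * (Delta - 1) by rewrite divfK// gt_eqF// subr_gt0.
have DK : delta * Delta = (Delta - 1) * (k + f0).
  by rewrite -eqD kE; field; rewrite gt_eqF.
have s1 : 0 < 1 - s by nra.
have K0 : 0 < k + f0 by nra.
have gap : delta < (1 - s) * (k + f0) by nra.
have : ((delta / (1 - s) - k)%:E < f_at0 f)%E.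
  by rewrite E0 lte_fin ltrBlDl ltr_pdivrMr// mulrC.
rewrite (f_at0E gen_f) => /ereal_sup_gt[y [v /=]].
rewrite in_itv /= => /andP[v0 v1] <-.
rewrite lte_fin ltrBlDl ltr_pdivrMr// mulrC => gv.
by exists v.
Qed.

(** For [0 < z < s < 1] this is the divergence between the two-point distributions [(z, 1 - z)] and
    [(z + 1 - s, s - z)], whose Bayes error is [s / 2] whatever [z] is. *)
Definition two_point_divergence (R : realType) (f : R -> R) (s z : R) : R :=
  z * f ((1 - s) / z + 1) + (1 - z) * f ((s - 1) / (1 - z) + 1).

(** * Values of the two-point divergence below and above [delta] *)

Section TwoPoint.
Variables (R : realType) (f : R -> R).
Hypothesis gen_f : divergence_generator f.

Let f1 : f 1 = 0.
Proof. by case: gen_f. Qed.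

Let cvx : @convex_function R R^o `]0, +oo[%classic f.
Proof. by case: gen_f. Qed.

(** The support line at [u] is at most [f 1 = 0] at 1, which bounds its slope from below. *)
Lemma minorant_ge_slope (u : R) : 1 < u -> exists p q,
  [/\ minorant f p q, p + q * u = f u & f u / (u - 1) <= q].
Proof.
move=> u1; have u0 : 0 < u by lra.
have [q minq] := convex_support cvx u0.
exists (f u - q * u), q; split; [by []|by rewrite subrK|].
by rewrite ler_pdivrMr ?subr_gt0//; have := minq 1 ltr01; rewrite f1; lra.
Qed.

Lemma minorant_ge_intercept (u : R) : 0 < u -> u < 1 -> exists p q,
  [/\ minorant f p q, q <= 0 & f u <= p].
Proof.
move=> u0 u1; have [q minq] := convex_support cvx u0.
have f0 := generator_ge0 gen_f u0.
have := minq 1 ltr01; rewrite f1 => min1.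
have q0 : q <= 0 by nra.
by exists (f u - q * u), q; split=> //; nra.
Qed.

Lemma two_point_divergence_continuous (s z : R) :
  0 < z -> z < s -> s < 1 -> {for z, continuous (two_point_divergence f s)}.
Proof.
move=> z0 zs s1.
have z1 : 1 - z != 0 by rewrite gt_eqF//; lra.
have u0 : 0 < (1 - s) / z + 1 by rewrite addr_gt0// divr_gt0//; lra.
have v0 : 0 < (s - 1) / (1 - z) + 1.
  by rewrite -(ltr_pM2r (_ : 0 < 1 - z)) ?mulrDl ?divfK//; lra.
have cf := convex_continuous cvx.
have c1 : (1 - x) @[x --> z] --> 1 - z.
  by apply: cvgB; [exact: cvg_cst|exact: cvg_id].
have c2 : f ((1 - s) / x + 1) @[x --> z] --> f ((1 - s) / z + 1).
  apply: (@cvg_comp _ _ _ (fun x => (1 - s) / x + 1) f _ _ _ _ (cf _ u0)).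
  apply: cvgD; last exact: cvg_cst.
  apply: cvgM; first exact: cvg_cst.
  by apply: cvgV; [rewrite gt_eqF|exact: cvg_id].
have c3 : f ((s - 1) / (1 - x) + 1) @[x --> z] --> f ((s - 1) / (1 - z) + 1).
  apply: (@cvg_comp _ _ _ (fun x => (s - 1) / (1 - x) + 1) f _ _ _ _ (cf _ v0)).
  apply: cvgD; last exact: cvg_cst.
  by apply: cvgM; [exact: cvg_cst|exact: cvgV].
by apply: cvgD; [apply: cvgM c2; exact: cvg_id|exact: cvgM c1 c3].
Qed.

(* For z close to s the first ratio is at least Delta and the second one at most
   v, so that Phi(z) >= (1 - s) (f(Delta) / (Delta - 1) + f(v)). *)
Lemma two_point_divergence_large (s z0 v Delta delta : R) :
  0 < z0 -> z0 < s -> 1 < Delta -> s * Delta < 1 -> 0 < v -> v < 1 ->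
  delta < (1 - s) * (f Delta / (Delta - 1) + f v) ->
  exists z, [/\ z0 < z, z < s & delta < two_point_divergence f s z].
Proof.
move=> z00 z0s D1 sD v0 v1 gap.
have s1 : s < 1 by nra.
(* With [z = s - e], the first bound makes the second ratio [e / (1 - z)] at most [v]; the second
   keeps [z] above [z0]. *)
pose e := Num.min (v * (1 - s)) ((s - z0) / 2).
have e0 : 0 < e by rewrite lt_min mulr_gt0 ?divr_gt0 ?subr_gt0.
have [e1 e2] : e <= v * (1 - s) /\ e <= (s - z0) / 2.
  by rewrite !ge_min !lexx orbT.
clearbody e; exists (s - e); split; [lra|lra|].
rewrite /two_point_divergence; set z := s - e; set u := _ / z + 1.
have [zlt zs] : z0 < z /\ z < s by rewrite /z; lra.
have uE : z * (u - 1) = 1 - s by rewrite /u addrK mulrC divfK// gt_eqF//; lra.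
have Du : Delta <= u.
  rewrite -lerBlDr ler_pdivlMr; last lra.
  by nra.
have := generator_slope_nondecreasing gen_f D1 Du.
set k := f Delta / (Delta - 1) in gap *.
have kE : f Delta = k * (Delta - 1) by rewrite divfK// gt_eqF// subr_gt0.
rewrite kE mulrAC ler_pM2r ?subr_gt0// => ku.
have kz : (1 - s) * k <= z * f u.
  by rewrite -uE -mulrA ler_pM2l ?(mulrC _ k)//; lra.
set w := (s - 1) / (1 - z) + 1.
have wE : w * (1 - z) = e by rewrite /w /z; field; rewrite gt_eqF//; lra.
have w0 : 0 < w by nra.
have wv : w <= v by nra.
have := generator_nonincreasing gen_f w0 wv v1.
have := generator_ge0 gen_f v0.
nra.
Qed.

Lemma two_point_divergence_small (s x y v Delta D delta : R) :
  0 <= x -> y <= 1 -> s = x + (1 - y) ->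
  1 < Delta -> s * Delta < 1 -> 0 < v -> v < 1 ->
  delta < (1 - s) * (f Delta / (Delta - 1) + f v) ->
  (forall p q p' q', minorant f p q -> minorant f p' q' ->
    p * x + q * y + (p' * (1 - x) + q' * (1 - y)) <= D) ->
  D < delta ->
  exists z, [/\ 0 < z, z < s & two_point_divergence f s z < delta].
Proof.
move=> x0 y1 sE D1 sD v0 v1 gap leD Ddelta.
have s1 : s < 1 by nra.
(* If [y = 1], then [x = s], and the minorants taken at [Delta] and [v] give [D >= (1 - s) * (f
   Delta / (Delta - 1) + f v) > delta], a contradiction. *)
have [y_lt1|y_ge1] := ltP y 1; last first.
  have {y_ge1}y_eq1 : y = 1 by lra.
  have [p [q [min1 pq qk]]] := minorant_ge_slope D1.
  have [p' [q' [min2 q'0 p'v]]] := minorant_ge_intercept v0 v1.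
  have := leD _ _ _ _ min1 min2; rewrite y_eq1.
  set k := f Delta / (Delta - 1) in gap qk.
  have kE : f Delta = k * (Delta - 1) by rewrite divfK// gt_eqF// subr_gt0.
  have xs : x = s by lra.
  have h1 : 0 <= (q - k) * (1 - s * Delta) by rewrite mulr_ge0; lra.
  have h2 : 0 <= (p' - f v) * (1 - s) by rewrite mulr_ge0; lra.
  have -> : p = f Delta - q * Delta by lra.
  rewrite kE xs; nra.
(* If [x > 0], take [z = x]: support lines at the ratios [y / x] and [(1 - y) / (1 - x)] turn the
   lower bound for [D] into exactly the two-point divergence. *)
move: x0; rewrite le_eqVlt => /predU1P[x0|x0]; last first.
  exists x; split=> //; first by lra.
  apply: le_lt_trans Ddelta.
  have u0 : 0 < (1 - s) / x + 1 by rewrite addr_gt0// divr_gt0//; lra.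
  have w0 : 0 < (s - 1) / (1 - x) + 1.
    by rewrite -(ltr_pM2r (_ : 0 < 1 - x)) ?mulrDl ?divfK ?gt_eqF//; lra.
  have [q minq] := convex_support cvx u0.
  have [q' minq'] := convex_support cvx w0.
  apply: le_trans (leD _ _ _ _ minq minq').
  rewrite /two_point_divergence le_eqVlt; apply/orP; left; apply/eqP.
  have -> : y = x + 1 - s by lra.
  by field; apply/andP; split; rewrite gt_eqF//; lra.
have s0 : 0 < s by lra.
have ys : y = 1 - s by lra.
(* If [x = 0], the first ratio is infinite, so only slopes count on the first piece; the second
   ratio is [s]. *)
have bound u : 1 < u -> f u / (u - 1) * (1 - s) + f s <= D.
  move=> u1; have [p [q [min1 _ qk]]] := minorant_ge_slope u1.
  have [q' minq'] := convex_support cvx s0.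
  apply: le_trans (leD _ _ _ _ min1 minq'); rewrite -x0 ys.
  have : 0 <= (q - f u / (u - 1)) * (1 - s) by rewrite mulr_ge0; lra.
  lra.
have lim0 : (s - 1) / (1 - 0) + 1 = s by rewrite subr0 divr1 subrK.
have cvg_f : f ((s - 1) / (1 - z) + 1) @[z --> 0] --> f s.
  have cvg0 : (s - 1) / (1 - z) + 1 @[z --> 0] --> (s - 1) / (1 - 0) + 1.
    apply: cvgD; last exact: cvg_cst.
    apply: cvgM; [exact: cvg_cst|apply: cvgV; first by rewrite subr0 oner_eq0].
    by apply: cvgB; [exact: cvg_cst|exact: cvg_id].
  rewrite lim0 in cvg0.
  exact: (@cvg_comp _ _ _ (fun z => (s - 1) / (1 - z) + 1) f _ _ _ cvg0
    (convex_continuous cvx s0)).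
have : \forall z \near 0^'+, f ((s - 1) / (1 - z) + 1) < f s + (delta - D).
  by apply: (cvgr_lt (f s)); [exact: cvg_at_right_filter cvg_f|lra].
move=> near_f; near (0 : R)^'+ => z; exists z.
have z0 : 0 < z by near: z; exact: nbhs_right_gt.
have zs : z < s by near: z; exact: nbhs_right_lt.
split=> //; rewrite /two_point_divergence.
have fz : f ((s - 1) / (1 - z) + 1) < f s + (delta - D) by near: z.
have w0 : 0 < (s - 1) / (1 - z) + 1.
  by rewrite -(ltr_pM2r (_ : 0 < 1 - z)) ?mulrDl ?divfK ?gt_eqF//; lra.
have := generator_ge0 gen_f w0.
(* For [u = (1 - s) / z + 1] the slope term is [z * f u], the first summand, hence at most
   [D - f s]; the second is below [f s + (delta - D)] for small [z]. *)
have := bound ((1 - s) / z + 1); rewrite ltrDr addrK divr_gt0 ?subr_gt0//.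
move=> /(_ isT); rewrite invf_div mulrA divfK ?gt_eqF ?subr_gt0//.
nra.
Unshelve. all: by end_near. Qed.

End TwoPoint.

(** * Contradiction through the intermediate value theorem *)

Theorem theorem1 (R : realType) (d : measure_display) (T : measurableType d)
    (mu : {measure set T -> \bar R}) (f : R -> R) (g1 g2 : T -> R)
    (delta Delta : R) :
  divergence_generator f ->
  is_density mu g1 ->
  is_density mu g2 ->
  0 < delta ->
  Delta_star_solution f delta Delta ->
  (f_divergence mu f g1 g2 < delta%:E)%E ->
  (alpha f delta Delta <= bayes_error mu g1 g2)%E.
Proof.
move=> gen_f dg1 dg2 delta0 solD fdiv_lt; rewrite leNgt; apply/negP.
rewrite (bayes_errorE dg1 dg2) /alpha lt_min.
have D1 := solD.1.
have x0 : 0 <= \int[mu]_(t in [set t | g1 t <= g2 t]) g1 t.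
  by apply: Rintegral_ge0 => t _; have [_ ? _] := dg1.
have y1 : \int[mu]_(t in [set t | g1 t <= g2 t]) g2 t <= 1.
  rewrite -subr_ge0 -Rintegral_setC//; last first.
    exact: measurable_density_le dg1 dg2.
  by apply: Rintegral_ge0 => t _; have [_ ? _] := dg2.
move: x0 y1; set x := Rintegral _ _ g1; set y := Rintegral _ _ g2.
move=> x0 y1 /andP[]; rewrite lte_fin => tD.
set s := x + (1 - y) in tD *; move=> t_lt.
(* This is the bound [s / 2 < 1 / (2 * Delta)] from the first term of the minimum. *)
have sD : s * Delta < 1.
  move: tD; rewrite invfM ltr_pM2l ?invr_gt0 ?ltr0n//.
  rewrite -(ltr_pM2r (_ : 0 < Delta)).
    by rewrite mulVf// gt_eqF//; lra.
  by lra.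
have [Dgt1 [v [v0 v1 gap]]] := Delta_star_gap gen_f delta0 solD sD.
have [D DE] : exists D : R, f_divergence mu f g1 g2 = D%:E.
  exists (fine (f_divergence mu f g1 g2)); rewrite fineK// ge0_fin_numE.
    exact: lt_trans fdiv_lt (ltry _).
  have [[_ ? _] [_ ? _]] := (dg1, dg2).
  by apply: integral_ge0 => t _; exact: fdiv_integrand_ge0.
move: fdiv_lt; rewrite DE lte_fin => Dlt.
have leD p q p' q' : minorant f p q -> minorant f p' q' ->
    p * x + q * y + (p' * (1 - x) + q' * (1 - y)) <= D.
  by move=> m m'; rewrite -lee_fin -DE; exact: f_divergence_ge.
have [z0 [z00 z0s small]] := two_point_divergence_small gen_f x0 y1 (erefl s)
  Dgt1 sD v0 v1 gap leD Dlt.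
have [z1 [z01 z1s large]] := two_point_divergence_large gen_f z00 z0s Dgt1 sD
  v0 v1 gap.
have s1 : s < 1 by nra.
have [z] : exists2 z, z \in `[z0, z1] & two_point_divergence f s z = delta.
  apply: IVT (ltW z01) _ _.
    apply: continuous_in_subspaceT => z.
    rewrite inE /= in_itv /= => /andP[zl zr].
    by apply: two_point_divergence_continuous => //; lra.
  by rewrite ge_min le_max (ltW small) (ltW large) orbT.
rewrite in_itv /= => /andP[zl zr] Phi_z; move: t_lt; apply/negP; rewrite -leNgt.
(* At [t = s / 2] the equation of [A_set] is the one solved by [z], and [0 < z0 <= z <= z1 < s < 1]
   gives the side conditions. *)
apply: ereal_inf_lbound; exists (z, 2^-1 * s) => //=.
rewrite mulrA divff// mul1r; split=> //; lra.
Qed.
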